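(* Let $\gamma \geq 0$ be an integer and let $\mathcal{M}$ be a unital $\gamma$-multiprojection algebra of height $h$, with unit $\mathbf{1}$ and endomorphisms $\pi_a$, $a \in [\gamma]$. Let $\mathrm{M}(\mathcal{M})$ be the $\gamma$-pluriassociative algebra constructed from $\mathcal{M}$. Then: (i) for any $a \in [h]$, $\mathbf{1}$ is an $a$-bar-unit of $\mathrm{M}(\mathcal{M})$; (ii) for any $a \leq b \in [h]$, $\mathrm{Halo}_a(\mathrm{M}(\mathcal{M}))$ is a subset of $\mathrm{Halo}_b(\mathrm{M}(\mathcal{M}))$; (iii) for any $a \in [h]$, the linear span of $\mathrm{Halo}_a(\mathrm{M}(\mathcal{M}))$ forms an $(h - a + 1)$-pluriassociative subalgebra of the $(h - a + 1)$-pluriassociative subalgebra of $\mathrm{M}(\mathcal{M})$ induced by $[a, h]$; (iv) for any $a \in [h]$, $\pi_a$ is the identity map if and only if $\mathbf{1}$ is an $a$-wire-unit of $\mathrm{M}(\mathcal{M})$.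
   Context: The ground field has characteristic zero; $[n] = \{1, \dots, n\}$; $[a, h]$ is the set of integers from $a$ to $h$; $a \uparrow a' := \max(a, a')$. A $\gamma$-multiassociative algebra is a vector space $\mathcal{M}$ with bilinear operations $\star_a$, $a \in [\gamma]$, satisfying $(x \star_a y) \star_b z = (x \star_b y) \star_{a'} z = x \star_{a''} (y \star_b z) = x \star_b (y \star_{a'''} z)$ for all $x, y, z \in \mathcal{M}$ and $a, a', a'', a''' \leq b \in [\gamma]$. An $a$-unit is an element $\mathbf{1}$ with $\mathbf{1} \star_a x = x = x \star_a \mathbf{1}$ for all $x$; a unit is an $a$-unit for some $a \in [\gamma]$. Such an algebra has at most one unit, and if this unit is a $b$-unit then it is an $a$-unit for all $a \in [b]$; the height is $0$ if there is no unit, and otherwise the greatest $h \in [\gamma]$ such that the unit is an $h$-unit. A $\gamma$-multiprojection algebra is a $\gamma$-multiassociative algebra with endomorphisms $\pi_a$, $a \in [\gamma]$ (linear maps commuting with all $\star_b$), satisfying $\pi_a \circ \pi_{a'} = \pi_{a \uparrow a'}$ for all $a, a' \in [\gamma]$. Its height is its height as a $\gamma$-multiassociative algebra. It is unital if it has a unit $\mathbf{1}$ as a $\gamma$-multiassociative algebra and $\pi_a(\mathbf{1}) = \mathbf{1}$ for all $a \in [h]$, where $h$ is its height. $\mathrm{M}(\mathcal{M})$ is the vector space $\mathcal{M}$ with the operations $x \dashv_a y := x \star_a \pi_a(y)$ and $x \vdash_a y := \pi_a(x) \star_a y$, $a \in [\gamma]$. It is a $\gamma$-pluriassociative algebra,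 that is, for all $x, y, z$ and $a, a' \in [\gamma]$: $(x \vdash_{a'} y) \dashv_a z = x \vdash_{a'} (y \dashv_a z)$; $(x \dashv_{a \uparrow a'} y) \dashv_a z = x \dashv_a (y \vdash_{a'} z)$; $(x \dashv_{a'} y) \vdash_a z = x \vdash_a (y \vdash_{a \uparrow a'} z)$; $(x \dashv_a y) \dashv_{a \uparrow a'} z = x \dashv_a (y \dashv_{a'} z)$; $(x \vdash_{a'} y) \vdash_a z = x \vdash_{a \uparrow a'} (y \vdash_a z)$. In a $\gamma$-pluriassociative algebra $\mathcal{P}$: an $a$-bar-unit is an element $e$ with $x \dashv_a e = x = e \vdash_a x$ for all $x$; the $a$-halo $\mathrm{Halo}_a(\mathcal{P})$ is the set of $a$-bar-units; an $a$-wire-unit is an element $e$ with $e \dashv_a x = x = x \vdash_a e$ for all $x$. For $C \subseteq [\gamma]$, the $\#C$-pluriassociative subalgebra of $\mathcal{P}$ induced by $C$ is the vector space $\mathcal{P}$ with only the operations $\dashv_c, \vdash_c$, $c \in C$, renumbered from $1$ to $\#C$ respecting their relative order. A subalgebra is a subspace stable under all the operations. *)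

(* Defs.v *)
From HB Require Import structures.
From mathcomp Require Export all_boot all_order all_algebra.
From mathcomp Require Export classical_sets.
Set Implicit Arguments.
Unset Strict Implicit.
Unset Printing Implicit Defensive.

Import Order.TTheory GRing.Theory.
Local Open Scope ring_scope.

(* The index set [g] = {1, ..., g} is encoded by the ordinal type 'I_g, whose *)
(* values are 0, ..., g - 1: the ordinal a stands for the index lbl a.  Since *)
(* lbl is increasing, indices are compared, and their maximum is taken,       *)
(* directly on ordinals; lbl only occurs when an index meets a height.        *)
Definition lbl (g : nat) (a : 'I_g) : nat := a.+1.

(* [a, h], for h at most g *)
Definition index_interval (g : nat) (a : 'I_g) (h : nat) : {set 'I_g} :=
  finset (fun c : 'I_g => (lbl a <= lbl c <= h)%N).

(* In starA the four indices a, a', a'', a''' vary independently below b. *)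
Record multiassociative (K : fieldType) (g : nat) (V : lmodType K) :=
  Multiassociative {
  star : 'I_g -> {bilinear V -> V -> V};
  starA : forall (a a' a'' a''' b : 'I_g) (x y z : V),
    (a <= b)%N -> (a' <= b)%N -> (a'' <= b)%N -> (a''' <= b)%N ->
    [/\ star b (star a x y) z = star a' (star b x y) z,
        star a' (star b x y) z = star a'' x (star b y z)
      & star a'' x (star b y z) = star b x (star a''' y z)] }.

Section Units.
Variables (K : fieldType) (g : nat) (V : lmodType K).
Variable A : multiassociative g V.

Definition index_unit (a : 'I_g) (u : V) : Prop :=
  forall x, star A a u x = x /\ star A a x u = x.

Definition is_unit (u : V) : Prop := exists a, index_unit a u.

Definition has_height (h : nat) : Prop :=
  ((~ exists u, is_unit u) /\ h = 0%N) \/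
  (exists u, is_unit u /\
     exists k : 'I_g, [/\ lbl k = h, index_unit k u
       & forall l, index_unit l u -> (l <= k)%N]).

End Units.

Record multiprojection (K : fieldType) (g : nat) (V : lmodType K) :=
  Multiprojection {
  mp_multiassociative :> multiassociative g V;
  mproj : 'I_g -> {linear V -> V};
  mproj_star : forall (a b : 'I_g) (x y : V),
    mproj a (star mp_multiassociative b x y) =
    star mp_multiassociative b (mproj a x) (mproj a y);
  mproj_comp : forall a a' : 'I_g,
    mproj a \o mproj a' =1 mproj (Order.max a a') }.

Definition unital (K : fieldType) (g : nat) (V : lmodType K)
    (M : multiprojection g V) : Prop :=
  exists2 u, is_unit M u &
    forall h, has_height M h ->
    forall a : 'I_g, (lbl a <= h)%N -> mproj M a u = u.

(* dashv is -|, vdash is |- *)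
Record pluriassociative (K : fieldType) (g : nat) (V : lmodType K) :=
  Pluriassociative {
  dashv : 'I_g -> {bilinear V -> V -> V};
  vdash : 'I_g -> {bilinear V -> V -> V};
  vdash_dashv : forall (a a' : 'I_g) (x y z : V),
    dashv a (vdash a' x y) z = vdash a' x (dashv a y z);
  dashv_max_vdash : forall (a a' : 'I_g) (x y z : V),
    dashv a (dashv (Order.max a a') x y) z = dashv a x (vdash a' y z);
  dashv_vdash_max : forall (a a' : 'I_g) (x y z : V),
    vdash a (dashv a' x y) z = vdash a x (vdash (Order.max a a') y z);
  dashv_dashv_max : forall (a a' : 'I_g) (x y z : V),
    dashv (Order.max a a') (dashv a x y) z = dashv a x (dashv a' y z);
  vdash_max_vdash : forall (a a' : 'I_g) (x y z : V),
    vdash a (vdash a' x y) z = vdash (Order.max a a') x (vdash a y z) }.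

Section Pluriassociative.
Variables (K : fieldType) (g : nat) (V : lmodType K).
Variable P : pluriassociative g V.

Definition bar_unit (a : 'I_g) (e : V) : Prop :=
  forall x, dashv P a x e = x /\ vdash P a e x = x.

Definition halo (a : 'I_g) : set V := bar_unit a.

Definition wire_unit (a : 'I_g) (e : V) : Prop :=
  forall x, dashv P a e x = x /\ vdash P a x e = x.

Definition subalgebra (S : set V) : Prop :=
  [/\ S 0,
      forall (c : K) x y, S x -> S y -> S (c *: x + y),
      forall (a : 'I_g) x y, S x -> S y -> S (dashv P a x y)
    & forall (a : 'I_g) x y, S x -> S y -> S (vdash P a x y)].

Variable C : {set 'I_g}.

(* Order.enum_val lists C in increasing order. *)
Let c_ (i : 'I_#|C|) : 'I_g := Order.enum_val i.

Fact enum_val_max (i j : 'I_#|C|) : c_ (Order.max i j) = Order.max (c_ i) (c_ j).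
Proof.
have mono : {mono c_ : i j / (i <= j)%O}.
  exact: (Order.le_enum_val (@le_total _ _)).
rewrite !maxElt (leW_mono mono); by case: ifP.
Qed.

Definition induced : pluriassociative #|C| V.
Proof.
apply: (@Pluriassociative K #|C| V
          (fun i => dashv P (c_ i)) (fun i => vdash P (c_ i))) => i j x y z;
  rewrite ?enum_val_max.
- exact: vdash_dashv.
- exact: dashv_max_vdash.
- exact: dashv_vdash_max.
- exact: dashv_dashv_max.
- exact: vdash_max_vdash.
Defined.

End Pluriassociative.

Definition linear_span (K : fieldType) (V : lmodType K) (S : set V) : set V :=
  fun x => exists (n : nat) (c : 'I_n -> K) (v : 'I_n -> V),
    (forall i, S (v i)) /\ x = \sum_(i < n) c i *: v i.

Section Construction.
Variables (K : fieldType) (g : nat) (V : lmodType K).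
Variable M : multiprojection g V.

Definition Mdashv (a : 'I_g) (x y : V) : V := star M a x (mproj M a y).
Definition Mvdash (a : 'I_g) (x y : V) : V := star M a (mproj M a x) y.

Fact Mdashv_bilinear a : bilinear_for *:%R *:%R (Mdashv a).
Proof.
split=> [y|x] c u v; rewrite /applyr /Mdashv /=; first by rewrite linearPl.
by rewrite linearP linearPr.
Qed.

Fact Mvdash_bilinear a : bilinear_for *:%R *:%R (Mvdash a).
Proof.
split=> [y|x] c u v; rewrite /applyr /Mvdash /=; last by rewrite linearPr.
by rewrite linearP linearPl.
Qed.

HB.instance Definition _ a := bilinear_isBilinear.Build K V V V *:%R *:%R
  (Mdashv a) (Mdashv_bilinear a).
HB.instance Definition _ a := bilinear_isBilinear.Build K V V V *:%R *:%R
  (Mvdash a) (Mvdash_bilinear a).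

Let mprojK a a' x : mproj M a (mproj M a' x) = mproj M (Order.max a a') x.
Proof. exact: mproj_comp. Qed.

Let star_star (a b c d : 'I_g) x y z : Order.max a b = Order.max c d ->
  star M b (star M a x y) z = star M c x (star M d y z).
Proof.
have starl (e f : 'I_g) : star M f (star M e x y) z =
    star M (Order.max e f) (star M (Order.max e f) x y) z.
  have [le_ef|le_fe] := leP e f.
    have lef : (e <= f)%N by [].
    by have [-> _ _] := @starA _ _ _ M e f f f f x y z lef
      (leqnn f) (leqnn f) (leqnn f).
  have lfe : (f <= e)%N by apply: ltnW.
  have [<- _ _] := @starA _ _ _ M e f e e e x y z (leqnn e) lfe
    (leqnn e) (leqnn e).
  by [].
rewrite starl => ->; set m := Order.max c d.
have [le_cd|lt_dc] := leP c d.
  have -> : m = d by apply/max_idPr.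
  by have [_ -> _] := @starA _ _ _ M d d c d d x y z (leqnn d) (leqnn d)
    le_cd (leqnn d).
have ldc : (d <= c)%N by apply: ltnW.
have -> : m = c by apply/max_idPl/ltW.
by have [_ -> ->] := @starA _ _ _ M c c c d c x y z (leqnn c) (leqnn c)
  (leqnn c) ldc.
Qed.

Definition pluri_of : pluriassociative g V.
Proof.
apply: (@Pluriassociative K g V
  (fun a => Mdashv a : {bilinear V -> V -> V})
  (fun a => Mvdash a : {bilinear V -> V -> V})) => a a' x y z;
  rewrite /= /Mdashv /Mvdash ?mproj_star ?mprojK; apply: star_star.
- by [].
- by rewrite maxC maxA maxxx.
- by rewrite [RHS]maxA maxxx maxC.
- by rewrite maxA maxxx.
- by rewrite [RHS]maxC maxA maxxx maxC.
Defined.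

End Construction.

(* Main.v *)
Require Import Defs.

(** For [a <= h], an element [e] is an [a]-bar-unit of [M(M)] iff [pi_a e] is an
    [a]-unit, i.e. iff [pi_a e = 1].  Hence the halo is a fibre of [pi_a] and its
    linear span is the preimage under [pi_a] of the line spanned by [1]; the
    statements then reduce to [pi_b = pi_b \o pi_a] for [a <= b]. *)

Import Order.TTheory GRing.Theory.
Local Open Scope ring_scope.

Section IndexUnits.
Set Implicit Arguments.
Unset Strict Implicit.
Variables (K : fieldType) (g : nat) (V : lmodType K) (A : multiassociative g V).

(** Insert [u] twice into [starA]: [u *_a (u *_b x) = u *_b (u *_b x)] collapses to [u *_a x = x],
    and [(x *_a u) *_b u = (x *_b u) *_b u] to [x *_a u = x]. *)
Lemma index_unitW (a b : 'I_g) (u : V) :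
  (a <= b)%N -> index_unit A b u -> index_unit A a u.
Proof.
move=> ab ub x; split.
  have [_ _] := starA A u u x ab ab ab (leqnn b).
  by rewrite !(ub _).1.
have [+ _ _] := starA A x u u ab (leqnn b) ab ab.
by rewrite !(ub _).2.
Qed.

(** Both are units for the smaller index, say [a], so [u = u *_a v = v]. *)
Lemma index_unit_inj (a b : 'I_g) (u v : V) :
  index_unit A a u -> index_unit A b v -> u = v.
Proof.
wlog ab : a b u v / (a <= b)%N => [wlog_ab ua vb|ua /(index_unitW ab) va].
  by case: (leqP a b) => [|/ltnW] ab; [|symmetry]; exact: (wlog_ab _ _ _ _ ab).
by rewrite -(va u).2 (ua v).1.
Qed.

Lemma is_unit_inj (u v : V) : is_unit A u -> is_unit A v -> u = v.
Proof. by move=> [a ua] [b vb]; exact: index_unit_inj ua vb. Qed.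

Lemma has_height_index_unit (h : nat) (u : V) : has_height A h -> is_unit A u ->
  (h <= g)%N /\ forall a : 'I_g, (lbl a <= h)%N -> index_unit A a u.
Proof.
move=> [[no_unit _] unit_u|[v [unit_v [k [<- vk _]]]] unit_u].
  by case: no_unit; exists u.
rewrite (is_unit_inj unit_u unit_v); split=> [|a ak]; first exact: ltn_ord.
exact: index_unitW ak vk.
Qed.

End IndexUnits.

(** As [lbl] shifts by one, the ordinals counted are the [c] with [a <= c < h]; [h <= g] ensures
    that ['I_g] contains them all. *)
Lemma card_index_interval (g h : nat) (a : 'I_g) :
  (lbl a <= h <= g)%N -> #|index_interval a h| = (h - lbl a + 1)%N.
Proof.
rewrite /lbl => /andP[ah hg]; rewrite -sum1_card.
under eq_bigl => c do rewrite inE /lbl ltnS.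
rewrite -(big_mkord (fun c => a <= c < h)%N (fun=> 1%N)).
under eq_bigl => c do rewrite -[(_ <= c)%N]andTb -andbA.
rewrite -(big_nat_widen _ _ _ (fun c => a <= c)%N _ hg).
rewrite -(big_nat_widenl _ _ _ predT) //.
by rewrite sum_nat_const_nat muln1 addn1 subnSK.
Qed.

Section UnitalMultiprojection.
Set Implicit Arguments.
Unset Strict Implicit.
Variables (K : fieldType) (g : nat) (V : lmodType K) (M : multiprojection g V).
Variables (h : nat) (one : V).
Hypothesis one_unit : forall a : 'I_g, (lbl a <= h)%N -> index_unit M a one.
Hypothesis mproj_one : forall a : 'I_g, (lbl a <= h)%N -> mproj M a one = one.

Lemma mproj_mproj (a b : 'I_g) (x : V) :
  (a <= b)%N -> mproj M b (mproj M a x) = mproj M b x.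
Proof. by move=> ab; have /= -> := mproj_comp M b a x; rewrite max_l. Qed.

Lemma mproj_mprojC (a b : 'I_g) (x : V) :
  (a <= b)%N -> mproj M a (mproj M b x) = mproj M b x.
Proof. by move=> ab; have /= -> := mproj_comp M a b x; rewrite max_r. Qed.

Lemma haloE (a : 'I_g) (e : V) : (lbl a <= h)%N ->
  halo (pluri_of M) a e <-> mproj M a e = one.
Proof.
move=> ah; split=> [bar_e|pe x].
  (* The bar-unit equations for [e] are the unit equations for [pi_a e]. *)
  apply: (index_unit_inj (a := a) _ (one_unit ah)) => x.
  by have [] := bar_e x; split.
by rewrite /= /Mdashv /Mvdash pe; have [] := one_unit ah x.
Qed.

(** Halo elements all map to [1], so [pi_a] sends a combination to the sum of its coefficients times
    [1]. Conversely, [x] cannot be rescaled into the halo when [c = 0]; two halo elements with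
    coefficients [1] and [c - 1] cover every [c]. *)
Lemma span_haloE (a : 'I_g) (x : V) : (lbl a <= h)%N ->
  linear_span (halo (pluri_of M) a) x <-> exists c, mproj M a x = c *: one.
Proof.
move=> ah; split=> [[n [c [v [halo_v ->]]]]|[c px]].
  exists (\sum_(i < n) c i); rewrite linear_sum scaler_suml.
  by apply: eq_bigr => i _; rewrite linearZ /= (haloE _ ah).1.
(* x = (x + (1 - c) 1) + (c - 1) 1 *)
exists 2, (fun i => if i == ord0 then 1 else c - 1),
  (fun i => if i == ord0 then x + (1 - c) *: one else one); split.
  move=> i; apply/(haloE _ ah); case: ifP => _; last exact: mproj_one.
  by rewrite linearD linearZ /= px mproj_one // -scalerDl addrC subrK scale1r.
rewrite big_ord_recl big_ord1 /= scale1r -addrA -scalerDl.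
by rewrite addrA subrK subrr scale0r addr0.
Qed.

Lemma bar_unit_one (a : 'I_g) : (lbl a <= h)%N -> bar_unit (pluri_of M) a one.
Proof. by move=> ah; apply/(haloE _ ah)/mproj_one. Qed.

Lemma halo_sub (a b : 'I_g) : (a <= b)%N -> (lbl b <= h)%N ->
  (halo (pluri_of M) a `<=` halo (pluri_of M) b)%classic.
Proof.
move=> ab bh e /(haloE _ (leq_ltn_trans ab bh)) pe; apply/(haloE _ bh).
(* [pi_b e = pi_b (pi_a e) = pi_b 1 = 1]. *)
by rewrite -(mproj_mproj _ ab) pe mproj_one.
Qed.

(** For [b] in [[a, h]], [pi_a] fixes the image of [pi_b], so [pi_a (x -|_b y) = pi_a x *_b pi_b y].
    Both factors are multiples of the [b]-unit [1], hence so is the product; [|-_b] is symmetric. *)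
Lemma span_halo_subalgebra (a : 'I_g) : (lbl a <= h)%N ->
  subalgebra (induced (pluri_of M) (index_interval a h))
    (linear_span (halo (pluri_of M) a)).
Proof.
move=> ah.
have mproj_line (b : 'I_g) x c : (a <= b)%N -> (lbl b <= h)%N ->
    mproj M a x = c *: one -> mproj M b x = c *: one.
  by move=> ab bh px; rewrite -(mproj_mproj _ ab) px linearZ /= mproj_one.
have in_interval (i : 'I_#|index_interval a h|) :
    (a <= Order.enum_val i)%N /\ (lbl (Order.enum_val i) <= h)%N.
  have := Order.EnumVal.enum_valP i.
  by rewrite inE /lbl ltnS => /andP.
split.
- by apply/(span_haloE _ ah); exists 0; rewrite linear0 scale0r.
- move=> c x y /(span_haloE _ ah)[d px] /(span_haloE _ ah)[e py].
  apply/(span_haloE _ ah); exists (c * d + e).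
  by rewrite linearP /= px py scalerDl scalerA.
- move=> i x y /(span_haloE _ ah)[d px] /(span_haloE _ ah)[e py].
  apply/(span_haloE _ ah); have [ab bh] := in_interval i.
  (* The scalar of the right factor is pulled out first, hence the order [e * d]. *)
  exists (e * d); rewrite /= /Mdashv mproj_star mproj_mprojC // px.
  by rewrite (mproj_line _ _ _ ab bh py) linearZr_LR /= (one_unit bh _).2 scalerA.
- move=> i x y /(span_haloE _ ah)[d px] /(span_haloE _ ah)[e py].
  apply/(span_haloE _ ah); have [ab bh] := in_interval i.
  exists (d * e); rewrite /= /Mvdash mproj_star mproj_mprojC // py.
  by rewrite (mproj_line _ _ _ ab bh px) linearZl_LR /= (one_unit bh _).1 scalerA.
Qed.

(** Since [1] is an [a]-unit, [1 -|_a x = 1 *_a pi_a x = pi_a x], which a wire-unit equates with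
    [x]. *)
Lemma mproj_id_wire_unit (a : 'I_g) : (lbl a <= h)%N ->
  mproj M a =1 id <-> wire_unit (pluri_of M) a one.
Proof.
move=> ah; rewrite /wire_unit /= /Mdashv /Mvdash; split=> [pid x|wire x].
  by rewrite pid; exact: one_unit.
by have [+ _] := wire x; rewrite (one_unit ah _).1.
Qed.

End UnitalMultiprojection.

Local Close Scope ring_scope.

Theorem proposition3p3p3 (K : fieldType) (charK0 : [pchar K]%R =i pred0)
    (g : nat) (V : lmodType K) (M : multiprojection g V) (h : nat) (one : V) :
  unital M -> has_height M h -> is_unit M one ->
  [/\ (forall a : 'I_g, lbl a <= h -> bar_unit (pluri_of M) a one),
      (forall a b : 'I_g, a <= b -> lbl b <= h ->
         (halo (pluri_of M) a `<=` halo (pluri_of M) b)%classic),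
      (forall a : 'I_g, lbl a <= h ->
         #|index_interval a h| = h - lbl a + 1 /\
         subalgebra (induced (pluri_of M) (index_interval a h))
           (linear_span (halo (pluri_of M) a)))
    & (forall a : 'I_g, lbl a <= h ->
         (mproj M a =1 id <-> wire_unit (pluri_of M) a one))].
Proof.
move=> [u unit_u mproj_u] height_h unit_one.
have mproj_one a : lbl a <= h -> mproj M a one = one.
  by rewrite (is_unit_inj unit_one unit_u); exact: mproj_u.
have [hg one_unit] := has_height_index_unit height_h unit_one.
split=> [a|a b|a ah|a].
- exact: bar_unit_one.
- exact: (halo_sub one_unit).
- split; first by apply: card_index_interval; rewrite ah.
  exact: (span_halo_subalgebra one_unit).
- exact: mproj_id_wire_unit.
Qed.
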